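(* Let $r\ge 0$ be an integer and let $$P(t)=a_1t+a_3t^3+\cdots+a_{2r+1}t^{2r+1},\qquad a_{2j+1}\geq 0\quad (j=0,1,\ldots,r),$$ be a real polynomial. Then $P\in\mathscr S$. Hence, for all $n\ge 1$ and all real numbers $\alpha_1\leq \alpha_2\leq \cdots\leq \alpha_n$ with $\sum_{k=1}^n\alpha_k=0$, $$\sum_{k=1}^n P(k\alpha_k)\geq 0.$$
   Context: $\mathscr S$ denotes the set of all functions $\phi:\mathbb R\to\mathbb R$ such that (1) $\phi$ is odd, and (2) $\phi$ is increasing and convex on $[0,\infty)$. ''Increasing'' is meant in the non-strict sense ($x\le y$ implies $\phi(x)\le\phi(y)$). *)

(* Defs.v *)
From mathcomp Require Import all_boot all_order all_algebra.
From mathcomp Require Import all_classical all_reals.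
From mathcomp Require Import interval_inference convex.

Set Implicit Arguments.
Unset Strict Implicit.
Unset Printing Implicit Defensive.

Import Order.TTheory GRing.Theory Num.Theory.

Local Open Scope classical_set_scope.
Local Open Scope ring_scope.

(* "Increasing" is non-strict. The set is ascribed the type [set R^o] because
   [convex_function] takes its domain in an lmodType. *)
Definition scrS (R : realType) : set (R -> R) :=
  [set phi |
    [/\ forall x, phi (- x) = - phi x,
        {in `[0, +oo[ &, {homo phi : x y / x <= y}} &
        convex_function (`[0, +oo[ : set R^o) phi]].

(* Main.v *)
Require Import Defs.
From mathcomp Require Import all_boot all_order all_algebra.
From mathcomp Require Import all_classical all_reals.
From mathcomp Require Import interval_inference convex ring lra zify.

Set Implicit Arguments.
Unset Strict Implicit.
Unset Printing Implicit Defensive.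

Import Order.TTheory GRing.Theory Num.Theory.

Local Open Scope classical_set_scope.
Local Open Scope ring_scope.

(** Split [alpha] into its positive and negative parts, both of total mass [A],
    and let [p] be the number of negative terms. The negative part is
    nonincreasing, so each [k * neg k] is at most [A] and the negative terms
    contribute at most [p * phi A] in absolute value. The [p] largest positive
    parts, weighted by [k], sum to at least [p * A]; by Jensen they contribute at
    least [p * phi A]. *)

Lemma convex_function_ge0P (R : realType) (f : R -> R) :
  convex_function (`[0, +oo[ : set R^o) f <->
  (forall t x y : R, 0 <= t <= 1 -> 0 <= x -> 0 <= y ->
     f (t * x + (1 - t) * y) <= t * f x + (1 - t) * f y).
Proof.
have mem0y (x : R) : (x \in [set` `[0, +oo[]) = (0 <= x).
  by rewrite mem_setE in_itv/= andbT.
split=> [fcvx t x y /andP[t0 t1] x0 y0|fcvx t x y].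
  by apply: (fcvx (Itv01 t0 t1)); rewrite mem0y.
by rewrite !mem0y => x0 y0; apply: fcvx => //; rewrite ge0 le1.
Qed.

(** Induction on [s]: the head gets weight 1/(m+1) and the average of the other [m] values gets
    m/(m+1). Scaling by the size makes the empty list harmless. *)
Lemma jensen_average (R : realType) (f : R -> R) (I : Type) (s : seq I)
    (F : I -> R) :
  convex_function (`[0, +oo[ : set R^o) f -> (forall i, 0 <= F i) ->
  (size s)%:R * f ((\sum_(i <- s) F i) / (size s)%:R) <= \sum_(i <- s) f (F i).
Proof.
move=> /convex_function_ge0P fcvx F0; elim: s => [|i s IHs].
  by rewrite !big_nil mul0r.
rewrite !big_cons/=; set m := size s in IHs *.
set S := \sum_(j <- s) F j in IHs *.
have S0 : 0 <= S by exact: sumr_ge0.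
have m1_gt0 : 0 < m.+1%:R :> R by rewrite ltr0n.
have mE : m.+1%:R = m%:R + 1 :> R by rewrite natr1.
(* For [m] = 0, division by zero returns 0, which matches the empty sum [S]. *)
have mS : m%:R * (S / m%:R) = S.
  rewrite mulrC; have [m0|m0] := eqVneq m 0%N; last by rewrite divfK ?pnatr_eq0.
  by rewrite m0 mulr0 /S (size0nil m0) big_nil.
have m0 : 0 <= m%:R :> R by rewrite ler0n.
have := fcvx (m.+1%:R)^-1 (F i) (S / m%:R) _ (F0 i) (divr_ge0 S0 m0).
have -> : 1 - m.+1%:R^-1 = m%:R / m.+1%:R :> R.
  by rewrite mE; field; rewrite -mE gt_eqF.
rewrite invr_ge0 ltW//= invf_le1// ler1n => /(_ isT).
rewrite [m%:R / _]mulrC -!mulrA mS -!mulrDr [_^-1 * (F i + S)]mulrC.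
rewrite -(ler_pM2l m1_gt0) mulrA mulfV ?gt_eqF// mul1r => /le_trans; apply.
by rewrite lerD2l.
Qed.

(** Multiply the induction hypothesis by the nonnegative base [t * x + (1 - t) * y]; what remains is
    nonnegative because [x - y] and [x ^+ m - y ^+ m] never have opposite signs. *)
Lemma convex_exprn (R : realType) (m : nat) :
  convex_function (`[0, +oo[ : set R^o) (fun x : R => x ^+ m).
Proof.
apply/convex_function_ge0P => t x y /andP[t0 t1] x0 y0.
have u0 : 0 <= 1 - t by rewrite subr_ge0.
elim: m => [|m IHm]; first by rewrite !expr0; lra.
rewrite !exprS; apply: (le_trans (ler_wpM2l _ IHm)).
  by rewrite addr_ge0// mulr_ge0.
(* the gap is t (1 - t) (x - y) (x^m - y^m) *)
have xym : 0 <= (x - y) * (x ^+ m - y ^+ m).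
  have [xy|/ltW yx] := leP x y.
    by rewrite mulr_le0// subr_le0// lerXn2r.
  by rewrite mulr_ge0// subr_ge0// lerXn2r.
rewrite -subr_ge0; have := mulr_ge0 (mulr_ge0 t0 u0) xym; congr (0 <= _).
ring.
Qed.

(** All three properties pass to nonnegative combinations, so odd powers suffice. *)
Lemma odd_nneg_poly_scrS (R : realType) (r : nat) (a : nat -> R) (P : {poly R}) :
  (forall j : nat, (j <= r)%N -> 0 <= a j.*2.+1) ->
  P = \sum_(j < r.+1) a j.*2.+1 *: 'X^(j.*2.+1) ->
  scrS (fun t : R => P.[t]).
Proof.
move=> a0 ->.
pose f (t : R) := \sum_(j < r.+1) a j.*2.+1 * t ^+ j.*2.+1.
rewrite (_ : (fun t => _) = f); last first.
  apply/funext => t; rewrite horner_sum; apply: eq_bigr => j _.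
  by rewrite hornerE hornerXn.
have a0' (j : 'I_r.+1) : 0 <= a j.*2.+1 by apply: a0; rewrite -ltnS.
split.
- move=> x; rewrite /f -sumrN; apply: eq_bigr => j _.
  by rewrite exprNn -signr_odd/= odd_double/= expr1 mulN1r mulrN.
- move=> x y; rewrite !in_itv/= !andbT => x0 y0 xy.
  by apply: ler_sum => j _; rewrite ler_wpM2l// lerXn2r.
- apply/convex_function_ge0P => t x y t01 x0 y0.
  rewrite !mulr_sumr -big_split/=; apply: ler_sum => j _.
  rewrite !(mulrCA _ (a _)) -mulrDr ler_wpM2l//.
  by have /convex_function_ge0P := @convex_exprn R j.*2.+1; apply.
Qed.

Lemma scrS_sum_ge0 (R : realType) (phi : R -> R) (n : nat) (alpha : nat -> R) :
  scrS phi -> (forall i j, (i <= j < n)%N -> alpha i <= alpha j) ->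
  \sum_(0 <= k < n) alpha k = 0 ->
  0 <= \sum_(0 <= k < n) phi (k.+1%:R * alpha k).
Proof.
move=> [phiN phi_homo phi_cvx] alpha_homo alpha_sum.
have phi0 : phi 0 = 0 by have := phiN 0; rewrite oppr0; lra.
have phi_le (x y : R) : 0 <= x -> x <= y -> phi x <= phi y.
  by move=> x0 xy; apply: phi_homo => //; rewrite in_itv/= andbT// (le_trans x0).
have phi_ge0 (x : R) : 0 <= x -> 0 <= phi x.
  by move=> x0; rewrite -phi0; exact: phi_le.
have [p pn [alpha_neg alpha_pos]] : exists2 p, (p <= n)%N &
    (forall k, (k < p)%N -> alpha k < 0) /\
    (forall k, (p <= k < n)%N -> 0 <= alpha k).
  (* The alternative [n <= p] covers the case where every term is negative, and it forces the least
     such [p] to be at most [n]. *)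
  have ex_p : exists p, (n <= p)%N || (0 <= alpha p) by exists n; rewrite leqnn.
  have [p np p_min] := ex_minnP ex_p; exists p; first by rewrite p_min ?leqnn.
  split=> k.
    move=> kp; rewrite ltNge; apply/negP => ak.
    by have := p_min k; rewrite ak orbT leqNgt kp => /(_ isT).
  move=> /andP[pk kn]; case/orP: np => [np|ap]; first lia.
  by apply: le_trans ap _; apply: alpha_homo; rewrite pk.
pose pos k := Num.max (alpha k) 0; pose neg k := Num.max (- alpha k) 0.
have pos_ge0 k : 0 <= pos k by rewrite le_max lexx orbT.
have neg_ge0 k : 0 <= neg k by rewrite le_max lexx orbT.
have pos_homo i j : (i <= j < n)%N -> pos i <= pos j.
  by move=> /alpha_homo; move=> ij; exact: le_max2.
have neg_homo i j : (i <= j < n)%N -> neg j <= neg i.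
  by move=> /alpha_homo ij; apply: le_max2; rewrite ?lerN2.
have pos0 k : (k < p)%N -> pos k = 0.
  by move=> /alpha_neg ak; apply/max_idPr; exact: ltW.
have neg0 k : (p <= k < n)%N -> neg k = 0.
  by move=> /alpha_pos ak; apply/max_idPr; rewrite oppr_le0.
have alphaE k : alpha k = pos k - neg k.
  rewrite /pos /neg; have [ak|ak] := leP (alpha k) 0.
    by rewrite max_l ?oppr_ge0// sub0r opprK.
  by rewrite max_r ?subr0// oppr_le0 ltW.
(* No additivity is involved: at each [k] one of [pos k] and [neg k] vanishes, so oddness and
   [phi 0 = 0] suffice. *)
have phiE k : phi (k.+1%:R * alpha k) =
    phi (k.+1%:R * pos k) - phi (k.+1%:R * neg k).
  rewrite /pos /neg; have [ak|ak] := leP (alpha k) 0.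
    by rewrite max_l ?oppr_ge0// mulr0 phi0 mulrN phiN; ring.
  by rewrite max_r ?mulr0 ?phi0 ?subr0// oppr_le0 ltW.
pose A := \sum_(0 <= k < n) neg k.
have A0 : 0 <= A by exact: sumr_ge0.
have posA : \sum_(0 <= k < n) pos k = A.
  apply/eqP; rewrite -subr_eq0 -sumrB; apply/eqP; rewrite -[RHS]alpha_sum.
  by apply: eq_bigr => k _; rewrite alphaE.
have neg_bound : \sum_(0 <= k < n) phi (k.+1%:R * neg k) <= p%:R * phi A.
  rewrite (@big_cat_nat _ _ _ p)//= [X in _ + X]big_nat_cond.
  rewrite [X in _ + X]big1 ?addr0.
    rewrite -[p in p%:R]subn0 mulr_natl -sumr_const_nat.
    rewrite big_nat_cond [leRHS]big_nat_cond; apply: ler_sum => k.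
    rewrite andbT/= => kp; apply: phi_le; first by rewrite mulr_ge0.
    rewrite -[k.+1]subn0 mulr_natl -sumr_const_nat.
    apply: (@le_trans _ _ (\sum_(0 <= i < k.+1) neg i)).
      rewrite big_nat_cond [leRHS]big_nat_cond; apply: ler_sum => i.
      by rewrite andbT/= => ik; apply: neg_homo; lia.
    rewrite /A (@big_cat_nat _ _ _ k.+1 0 n)//=; last lia.
    by rewrite lerDl sumr_ge0.
  by move=> k; rewrite andbT => /neg0 ->; rewrite mulr0 phi0.
pose Y := \sum_(n - p <= k < n) k.+1%:R * pos k.
have YA : p%:R * A <= Y.
  pose T := \sum_(n - p <= k < n) pos k.
  have AT : A = \sum_(0 <= k < n - p) pos k + T.
    by rewrite -posA -big_cat_nat//= leq_subr.
  (* Any [m] bounding from below the weights of the nonzero terms of [T] gives a bound on [Y]. *)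
  have YmT m :
      (forall k, (n - p <= k < n)%N -> (m <= k.+1)%N || (pos k == 0)) ->
      m%:R * T <= Y.
    move=> mle; rewrite /T mulr_sumr /Y big_nat_cond [leRHS]big_nat_cond.
    apply: ler_sum => k; rewrite andbT => /mle /orP[mk|/eqP->].
      by rewrite ler_wpM2r// ler_nat.
    by rewrite !mulr0.
  (* If [n - p <= p], the last [p] indices contain every nonzero [pos k], so [T] is all of [A], and
     those terms have weight above [p]. *)
  have [np|pnp] := leqP (n - p) p.
    rewrite AT big_nat_cond big1 ?add0r; last first.
      by move=> k; rewrite andbT/= => knp; apply: pos0; lia.
    apply: YmT => k _; case: (leqP p k.+1) => //= kp.
    by rewrite pos0//; lia.
  apply: le_trans (YmT (n - p)%N _); last by move=> k /andP[nk _]; rewrite leqW.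
  (* compare the last [p] positive parts and the earlier ones with [pos (n - p)] *)
  set c := pos (n - p)%N.
  have [p0|p0] := posnP p; first by rewrite p0 mul0r mulr_ge0// sumr_ge0.
  have cT : p%:R * c <= T.
    rewrite mulr_natl -[X in _ *+ X](subKn pn) -sumr_const_nat.
    rewrite /T big_nat_cond [leRHS]big_nat_cond.
    by apply: ler_sum => k; rewrite andbT => nk; apply: pos_homo.
  have Sc : \sum_(0 <= k < n - p) pos k <= (n - p - p)%:R * c.
    rewrite (@big_cat_nat _ _ _ p)//=; last lia.
    rewrite big_nat_cond big1 ?add0r; last by move=> k; rewrite andbT/= => /pos0.
    rewrite mulr_natl -sumr_const_nat big_nat_cond [leRHS]big_nat_cond.
    by apply: ler_sum => k; rewrite andbT => nk; apply: pos_homo; lia.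
  have np_ge0 : 0 <= (n - p - p)%:R :> R by rewrite ler0n.
  (* Writing n - p as (n - 2p) + p cancels p T on both sides. The rest follows through p (n - 2p) c,
     by [Sc] and then [cT]. *)
  rewrite AT mulrDr -{2}(subnK (ltnW pnp)) natrD mulrDl lerD2r.
  apply: le_trans (ler_wpM2l (ler0n _ _) Sc) _.
  by rewrite mulrCA ler_wpM2l.
rewrite (eq_bigr _ (fun k _ => phiE k)) sumrB subr_ge0.
apply: le_trans neg_bound _.
apply: (@le_trans _ _ (\sum_(n - p <= k < n) phi (k.+1%:R * pos k))); last first.
  rewrite [leRHS](@big_cat_nat _ _ _ (n - p))//= ?leq_subr//.
  by rewrite lerDr sumr_ge0// => k _; rewrite phi_ge0// mulr_ge0.
have := @jensen_average R phi _ (index_iota (n - p) n)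
  (fun k => k.+1%:R * pos k) phi_cvx.
rewrite size_iota subKn// => /(_ (fun k => mulr_ge0 (ler0n _ _) (pos_ge0 k))).
(* For positive [p], [YA] says that the average [Y / p] is at least [A], and [phi] is monotone
   there. *)
apply: le_trans; have [->|p0] := posnP p; first by rewrite !mul0r.
rewrite ler_wpM2l// phi_le// ler_pdivlMr ?ltr0n// mulrC.
exact: YA.
Qed.

(* alpha is indexed from 0, so alpha i is the paper's alpha_(i+1). *)
Theorem mainTheorem3 (R : realType) (r : nat) (a : nat -> R) (P : {poly R})
    (ha : forall j : nat, (j <= r)%N -> 0 <= a j.*2.+1)
    (hP : P = \sum_(j < r.+1) a j.*2.+1 *: 'X^(j.*2.+1)) :
  scrS (fun t : R => P.[t]) /\
  forall (n : nat) (alpha : 'I_n -> R),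
    (1 <= n)%N ->
    (forall i j : 'I_n, (i <= j)%N -> alpha i <= alpha j) ->
    \sum_(k < n) alpha k = 0 ->
    0 <= \sum_(k < n) P.[k.+1%:R * alpha k].
Proof.
have PS := odd_nneg_poly_scrS ha hP; split=> // -[//|n] alpha _ alpha_homo alpha_sum.
(* [inord] extends [alpha] to all of [nat]; it needs the ordinal type to be nonempty, hence the size
   [n.+1]. *)
have := @scrS_sum_ge0 _ _ n.+1 (fun k => alpha (inord k)) PS.
rewrite !big_mkord; under eq_bigr do rewrite inord_val; move=> P_sum.
under eq_bigr do rewrite -[alpha _](congr1 alpha (inord_val _)).
apply: P_sum => // i j /andP[ij jn]; apply: alpha_homo.
by rewrite !inordK// (leq_ltn_trans ij).
Qed.
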